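(* Let $K$ be a cyclic cubic field with conductor $f\geq 10^{14}$ (so $f$ is a prime with $f\equiv 1 \pmod 3$). Let $q_1<q_2$ be the two smallest primes that are cubic non-residues modulo $f$. If $q_1=2$, then $K$ is not norm-Euclidean.
   Context: A number field $K$ with ring of integers $\mathcal{O}_K$ and norm $N$ is norm-Euclidean if for every $\alpha\in K$ there is $\beta\in\mathcal{O}_K$ with $|N(\alpha-\beta)|<1$. For a prime $f\equiv 1\pmod 3$, fix a Dirichlet character $\chi$ modulo $f$ of order $3$ (there are two, complex conjugate to each other). An integer $n$ is a cubic non-residue modulo $f$ if $\chi(n)\notin\{0,1\}$ (this does not depend on the choice of $\chi$). *)

(* Defs.v *)
From mathcomp Require Import all_boot all_order all_algebra.
From mathcomp Require Import all_fingroup all_solvable all_field.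

Set Implicit Arguments.
Unset Strict Implicit.
Unset Printing Implicit Defensive.

Import Order.TTheory GRing.Theory Num.Theory.
Local Open Scope ring_scope.

Definition cyclic_cubic (K : splittingFieldType rat) : Prop :=
  [/\ galois 1 {:K}, cyclic 'Gal({:K} / 1)%g & \dim {:K} = 3%N].

(* K embeds in Q(zeta_m), realised as the subfield Q[z] of algC. Q(zeta_m) is
   normal over Q, so the choice of phi and z is immaterial. There is no
   primitive root of order 0, so m is positive. *)
Definition embeds_in_cyclotomic (K : fieldExtType rat) (m : nat) : Prop :=
  exists (phi : {rmorphism K -> algC}) (z : algC), m.-primitive_root z /\
    forall x : K, exists p : {poly rat}, phi x = (map_poly ratr p).[z].

Definition is_conductor (K : fieldExtType rat) (f : nat) : Prop :=
  embeds_in_cyclotomic K f /\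
  forall m : nat, embeds_in_cyclotomic K m -> (f <= m)%N.

(* galNorm takes its values in the copy Q.1 of Q inside K; the norm below is
   the corresponding rational number, see fieldNormE. *)
Definition fieldNorm (K : splittingFieldType rat) (x : K) : rat :=
  coord [tuple (1 : K)] ord0 (galNorm 1 {:K} x).

Lemma fieldNormE (K : splittingFieldType rat) (x : K) :
  galois 1 {:K} -> (fieldNorm x)%:A = galNorm 1 {:K} x.
Proof.
move=> galK.
have Nin : galNorm 1 {:K} x \in <<[tuple (1 : K)%R]>>%VS.
  by rewrite span_seq1; apply: mem_galNorm; rewrite ?memvf.
by rewrite [RHS](coord_span Nin) big_ord1.
Qed.

Definition norm_Euclidean (K : splittingFieldType rat) : Prop :=
  forall a : K, exists b : K,
    integralOver (intr : int -> K) b /\ `|fieldNorm (a - b)| < 1.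

Definition dirichlet_character (f : nat) (chi : int -> algC) : Prop :=
  [/\ chi 1 = 1,
      forall m n : int, chi (m * n) = chi m * chi n,
      forall m n : int, (m = n %[mod f])%Z -> chi m = chi n
    & forall n : int, chi n = 0 <-> ~~ coprimez n f].

(* d is the least positive exponent for which chi ^+ d is the principal
   character modulo f. *)
Definition character_order (f : nat) (chi : int -> algC) (d : nat) : Prop :=
  [/\ (0 < d)%N,
      forall n : int, coprimez n f -> chi n ^+ d = 1
    & forall e : nat, (0 < e < d)%N ->
        exists2 n : int, coprimez n f & chi n ^+ e != 1].

(* The predicate attached to a character chi of order 3 modulo f; it is the
   same for the two such characters when f is a prime congruent to 1 mod 3. *)
Definition cubic_nonresidue (chi : int -> algC) (n : int) : bool :=
  (chi n != 0) && (chi n != 1).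

Definition two_smallest_prime_nonresidues
    (chi : int -> algC) (q1 q2 : nat) : Prop :=
  [/\ prime q1 && cubic_nonresidue chi q1,
      prime q2 && cubic_nonresidue chi q2,
      (q1 < q2)%N
    & forall p : nat, prime p -> cubic_nonresidue chi p ->
        (q1 <= p)%N /\ (p <> q1 -> (q2 <= p)%N)].

(* Main.v *)
(* A cyclic cubic field K of prime conductor f lies in Q(zeta) for a primitive
   f-th root of unity zeta, and f is totally ramified in K: the product pi of
   the 1 - zeta^k over the cubes k mod f lies in K and has norm f.  If K is
   norm-Euclidean and a = n^3 mod f with 0 < a < f, then dividing n by pi yields
   an integer x = n - pi b whose norm is congruent to n^3 mod f and smaller than
   f in absolute value, so a or a - f is the norm of an integer (Heilbronn).
   A prime p that is a cubic non-residue is inert, so it divides norms of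
   integers to an exponent divisible by 3.  Hence it suffices to find a = q r,
   where q = q2, such that a is a cube mod f, q^2 does not divide r, and f - a
   is congruent to 2 mod 4.

   If 260 q^2 <= f, such an r exists in the progression c + 4(i + j) with
   i, j < f/(8q).  Otherwise chi would avoid the value 1/chi(q) on this
   progression, up to multiples of q^2, so that the sums of chi over i would all
   have modulus about f/(16q), in contradiction with their second moment.

   If 260 q^2 > f, every odd number m with 260 m^2 <= f is a product of
   residues.  But f = 262 u v +- s with such u, v, s, obtained from Fermat's
   identity u v = t^2 - d^2, and then 1 = chi(s) = chi(262 u v) = chi(2). *)
From Stdlib Require Import ZArith Lia.
Require Import Defs.
From mathcomp Require Import all_boot all_order all_algebra.
From mathcomp Require Import all_fingroup all_solvable all_field.
From mathcomp Require Import ring zify.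

Set Implicit Arguments.
Unset Strict Implicit.
Unset Printing Implicit Defensive.

Import Order.TTheory GRing.Theory Num.Theory.
Local Open Scope ring_scope.

(* The key Z is taken by MathComp's int_scope. *)
Delimit Scope Z_scope with coqZ.

(** * Automorphisms and traces in the cyclotomic field *)

(** The map z -> z^k of Q(z), extended to all of [algC]. The extension is an arbitrary choice, so
    composition laws hold only on Q(z); [idfun] is a placeholder for [k] not coprime to [f]. *)
Definition cycaut (f k : nat) : {rmorphism algC -> algC} :=
  if @boolP (coprime k f) is AltTrue cokf then sval (Qn_aut_exists cokf)
  else idfun.

Lemma cycautE f k (w : algC) :
  coprime k f -> w ^+ f = 1 -> cycaut f k w = w ^+ k.
Proof.
rewrite /cycaut; case: {-}_ / boolP => [cokf _ | /negP //].
by case: (Qn_aut_exists _) => u /= uE; apply: uE.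
Qed.

Definition in_Q_adjoin (z x : algC) : Prop :=
  exists p : {poly rat}, x = (map_poly ratr p).[z].

Section QAdjoin.

Variable z : algC.

Lemma in_Q_adjoin_rat a : in_Q_adjoin z (ratr a).
Proof. by exists a%:P; rewrite map_polyC hornerC. Qed.

Lemma in_Q_adjoin_nat n : in_Q_adjoin z n%:R.
Proof. by rewrite -(ratr_nat _ n); apply: in_Q_adjoin_rat. Qed.

Lemma in_Q_adjoin_gen : in_Q_adjoin z z.
Proof. by exists 'X; rewrite map_polyX hornerX. Qed.

Lemma in_Q_adjoinD x y :
  in_Q_adjoin z x -> in_Q_adjoin z y -> in_Q_adjoin z (x + y).
Proof. by case=> p -> [q ->]; exists (p + q); rewrite rmorphD hornerD. Qed.

Lemma in_Q_adjoinN x : in_Q_adjoin z x -> in_Q_adjoin z (- x).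
Proof. by case=> p ->; exists (- p); rewrite rmorphN hornerN. Qed.

Lemma in_Q_adjoinM x y :
  in_Q_adjoin z x -> in_Q_adjoin z y -> in_Q_adjoin z (x * y).
Proof. by case=> p -> [q ->]; exists (p * q); rewrite rmorphM hornerM. Qed.

Lemma in_Q_adjoinX x n : in_Q_adjoin z x -> in_Q_adjoin z (x ^+ n).
Proof. by case=> p ->; exists (p ^+ n); rewrite rmorphXn horner_exp. Qed.

Lemma in_Q_adjoin_prod (I : finType) (P : pred I) (F : I -> algC) :
  (forall i, P i -> in_Q_adjoin z (F i)) -> in_Q_adjoin z (\prod_(i | P i) F i).
Proof.
apply: (big_ind (in_Q_adjoin z)); first exact: (in_Q_adjoin_nat 1).
exact: in_Q_adjoinM.
Qed.

End QAdjoin.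

Section Cyclotomic.

Variables (f : nat) (z : algC).
Hypotheses (f_prime : prime f) (z_prim : f.-primitive_root z).

Local Notation tau := (cycaut f).
Local Notation "'Qz'" := (in_Q_adjoin z).

Let f_gt0 : (0 < f)%N. Proof. exact: prime_gt0. Qed.

Lemma coprime_lt_prime k : (0 < k < f)%N -> coprime k f.
Proof.
move=> /andP[k0 kf]; rewrite coprime_sym prime_coprime //.
by apply/negP => /(dvdn_leq k0); rewrite leqNgt kf.
Qed.

Lemma cycaut_z k : coprime k f -> tau k z = z ^+ k.
Proof. by move=> cokf; rewrite cycautE // prim_expr_order. Qed.

Lemma cycaut_horner k p : coprime k f ->
  tau k (map_poly ratr p).[z] = (map_poly ratr p).[z ^+ k].
Proof.
move=> cokf; rewrite -horner_map -map_poly_comp cycaut_z //=; congr _.[_].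
by apply: eq_map_poly => a /=; rewrite fmorph_rat.
Qed.

Lemma cycautM j k x : coprime j f -> coprime k f -> Qz x ->
  tau (j * k)%N x = tau j (tau k x).
Proof.
move=> cojf cokf [p ->]; rewrite !cycaut_horner ?coprimeMl ?cojf //.
rewrite -horner_map -map_poly_comp rmorphXn cycaut_z //= -exprM; congr _.[_].
by apply: eq_map_poly => a /=; rewrite fmorph_rat.
Qed.

Lemma cycaut_mod j k x : coprime j f -> coprime k f -> j = k %[mod f] -> Qz x ->
  tau j x = tau k x.
Proof.
move=> cojf cokf jk [p ->]; rewrite !cycaut_horner //; congr _.[_].
by apply/eqP; rewrite (eq_prim_root_expr z_prim) jk.
Qed.

Lemma cycaut1 x : Qz x -> tau 1 x = x.
Proof. by case=> p ->; rewrite cycaut_horner ?coprime1n // expr1. Qed.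

Lemma in_Q_adjoin_cycaut k x : coprime k f -> Qz x -> Qz (tau k x).
Proof.
move=> cokf [p ->]; rewrite cycaut_horner //.
exists (p \Po 'X^k); rewrite map_comp_poly map_polyXn horner_comp.
by rewrite hornerXn.
Qed.

Lemma sum_prim_root_exp i :
  \sum_(0 <= k < f) z ^+ (k * i) = if (f %| i)%N then f%:R else 0.
Proof.
rewrite big_mkord.
under eq_bigr => k _ do rewrite mulnC exprM.
have [fi|nfi] := ifP.
  have -> : z ^+ i = 1 by apply/eqP; rewrite -(prim_order_dvd z_prim).
  rewrite (eq_bigr (fun=> 1)) => [|k _]; last exact: expr1n.
  by rewrite sumr_const card_ord.
have w1 : z ^+ i - 1 != 0 by rewrite subr_eq0 -(prim_order_dvd z_prim) nfi.
apply: (mulfI w1); rewrite -subrX1 mulr0 exprAC (prim_expr_order z_prim).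
by rewrite expr1n subrr.
Qed.

(** As [f] is prime, the exponents 1, ..., f - 1 index the whole Galois group of Q(z), and this is
    the trace to Q. *)
Definition cyclotomic_trace x := \sum_(1 <= k < f) tau k x.
Local Notation T := cyclotomic_trace.

Lemma trace_rat x : Qz x -> T x \in Crat.
Proof.
case=> p ->; rewrite /T.
under eq_big_nat => k kf do rewrite cycaut_horner ?coprime_lt_prime // horner_poly.
rewrite exchange_big /=; apply: rpred_sum => i _.
rewrite -mulr_sumr; apply: rpredM; first by rewrite Crat_rat.
under eq_bigr => k _ do rewrite -exprM.
have := sum_prim_root_exp i; rewrite (big_ltn f_gt0) mul0n expr0.
move=> /(canRL (addKr _)) ->.
rewrite rpredD ?rpredN ?rpred1 //; case: ifP => _; rewrite ?rpred0 //.
exact: rpred_nat.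
Qed.

Lemma fixed_rat x : Qz x -> (forall k, coprime k f -> tau k x = x) ->
  x \in Crat.
Proof.
move=> Qx fix_x; have := trace_rat Qx; rewrite /T.
under eq_big_nat => k kf do rewrite fix_x ?coprime_lt_prime //.
rewrite sumr_const_nat -mulr_natr => Rx.
have nz : (f - 1)%:R != 0 :> algC.
  by rewrite pnatr_eq0 -lt0n subn_gt0 prime_gt1.
by rewrite -(mulfK nz x) rpred_div ?rpred_nat.
Qed.

(* Fourier inversion: after exchanging the sums over i and over the
   automorphisms z |-> z^k, only k = 1 survives. *)
Lemma trace_reconstruct x : Qz x ->
  f%:R * x = \sum_(0 <= i < f) T (x * z ^+ (f - i)) * z ^+ i.
Proof.
move=> Qx.
(* The factor [f.-1 * k + 1] is 1 - k modulo [f], written without subtraction. *)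
have E i k : (i < f)%N -> (1 <= k < f)%N ->
    tau k (x * z ^+ (f - i)) * z ^+ i = tau k x * z ^+ (i * (f.-1 * k + 1)).
  move=> i_lt k_lt; rewrite rmorphM rmorphXn cycaut_z ?coprime_lt_prime //.
  rewrite -exprM -mulrA -exprD; congr (_ * _); apply/eqP.
  rewrite (eq_prim_root_expr z_prim) mulnDr muln1 eqn_modDr.
  rewrite mulnC [(i * _)%N]mulnA; apply/eqP.
  rewrite -modnMml -[RHS]modnMml; congr ((_ * k) %% f)%N.
  apply/eqP; rewrite -(eqn_modDr i) subnK 1?ltnW // -mulnSr prednK //.
  by rewrite modnn modnMl.
rewrite [RHS](_ : _ = \sum_(0 <= i < f) \sum_(1 <= k < f)
    tau k x * z ^+ (i * (f.-1 * k + 1))).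
  rewrite exchange_big /=.
  under eq_big_nat => k kf do rewrite -mulr_sumr sum_prim_root_exp.
  rewrite big_ltn ?prime_gt1 // muln1 addn1 prednK // dvdnn cycaut1 // mulrC.
  rewrite big_nat big1 ?addr0 // => k /andP[k1 kf].
  suff /negPf-> : ~~ (f %| f.-1 * k + 1)%N by rewrite mulr0.
  apply/negP => fd; have : (f %| k.-1)%N.
    have : (f %| f.-1 * k + 1 + k.-1)%N.
      rewrite -addnA add1n prednK ?(ltnW k1) // addnC -mulSn prednK //.
      exact: dvdn_mulr.
    by rewrite dvdn_addr.
  move/dvdn_leq; case: k k1 kf {fd} => [|[|k]] //= _ kf /(_ isT).
  by rewrite leqNgt (ltn_trans _ kf).
apply: eq_big_nat => i /andP[_ i_lt]; rewrite /T mulr_suml.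
by apply: eq_big_nat => k kf; rewrite E.
Qed.

End Cyclotomic.

(** * Frobenius congruences and the prime above the conductor *)

Lemma polyFp_Frobenius p (q : {poly 'F_p}) : prime p ->
  q ^+ p = q \Po 'X^p.
Proof.
move=> p_pr; have pc : p \in [pchar {poly 'F_p}].
  by rewrite pchar_poly pchar_Fp.
elim/poly_ind: q => [|q c IHq].
  by rewrite comp_poly0 expr0n eqn0Ngt prime_gt0.
rewrite -(pFrobenius_autE pc) pFrobenius_autD_comm; last exact: mulrC.
rewrite !pFrobenius_autE exprMn IHq comp_polyD comp_polyM comp_polyX.
have := expf_card c; rewrite card_Fp // => cp.
by rewrite comp_polyC -polyC_exp cp.
Qed.

Lemma Aint_horner (q : {poly int}) x : x \in Aint ->
  (map_poly intr q).[x] \in Aint.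
Proof.
move=> Ax; rewrite horner_poly; apply: rpred_sum => i _.
by rewrite rpredM ?rpredX ?Aint_int.
Qed.

(** By Frobenius over 'F_p, the integer polynomial q^p - q(X^p) has all coefficients divisible by
    [p]; the quotient polynomial takes algebraic integer values at [x]. *)
Lemma Aint_Frobenius p (q : {poly int}) x : prime p -> x \in Aint ->
  ((map_poly intr q).[x] ^+ p == (map_poly intr q).[x ^+ p] %[mod p%:R])%A.
Proof.
move=> p_pr Ax; pose r := q ^+ p - (q \Po 'X^p).
have r_p i : (p %| r`_i)%Z.
  rewrite (dvdz_pcharf (pchar_Fp p_pr)) -(coef_map intr) /=.
  have -> : map_poly intr r = (map_poly intr q : {poly 'F_p}) ^+ p
      - (map_poly intr q \Po 'X^p).
    by rewrite /r rmorphB rmorphXn /= map_comp_poly map_polyXn.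
  by rewrite polyFp_Frobenius // subrr coef0.
pose s := \poly_(i < size r) (r`_i %/ p)%Z.
have Dr : r = p%:Z%:P * s.
  apply/polyP => i; rewrite coefCM coef_poly; case: ltnP => [_|ri].
    by rewrite mulrC divzK.
  by rewrite mulr0 nth_default.
have -> : (map_poly intr q).[x] ^+ p
    = (map_poly intr q).[x ^+ p] + p%:R * (map_poly intr s).[x].
  apply/eqP; rewrite addrC -subr_eq -horner_exp -(hornerXn x p) -horner_comp.
  rewrite -(map_polyXn intr) -map_comp_poly -rmorphXn -hornerN -hornerD.
  by rewrite -rmorphB -/r Dr rmorphM /= map_polyC hornerM hornerC.
rewrite -[X in eqAmod _ _ X]addr0 eqAmodDl eqAmodMr0 //.
exact: Aint_horner.
Qed.

Section ConductorPrime.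

Variables (f : nat) (z : algC).
Hypotheses (f_prime : prime f) (z_prim : f.-primitive_root z).

Lemma prod_1subX : \prod_(1 <= k < f) (1 - z ^+ k) = f%:R.
Proof.
have f_gt0 := prime_gt0 f_prime.
have := factor_Xn_sub_1 z_prim; rewrite subrX1 (big_ltn f_gt0) expr0.
move/(mulfI (monic_neq0 (monicXsubC 1)))/(congr1 (horner^~ 1)).
rewrite horner_prod horner_sum.
under eq_bigr => k _ do rewrite hornerXsubC.
move=> ->; rewrite (eq_bigr (fun=> 1)) => [|k _].
  by rewrite sumr_const card_ord.
by rewrite hornerXn expr1n.
Qed.

Lemma lambda_dvd k : (1 - z ^+ k == 0 %[mod 1 - z])%A.
Proof.
have -> : 1 - z ^+ k = (1 - z) * \sum_(i < k) z ^+ i.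
  by rewrite -opprB subrX1 -mulNr opprB.
rewrite eqAmodMr0 //; by apply: rpred_sum => i _; rewrite rpredX // (Aint_prim_root z_prim).
Qed.

(** Multiplying the conjugates of m / (1 - z) gives m^(f-1) / f, which is integral and rational;
    hence [f] divides a power of [m]. *)
Lemma lambda_dvd_int (m : int) : (m%:~R == 0 %[mod 1 - z])%A -> (f %| m)%Z.
Proof.
have z1 : 1 - z != 0.
  rewrite subr_eq0 eq_sym -(expr1 z) -(prim_order_dvd z_prim).
  by rewrite dvdn1 neq_ltn prime_gt1 ?orbT.
rewrite eqAmod0 unfold_in (negPf z1) => Aw.
have : m%:~R ^+ f.-1 / f%:R \in Aint.
  rewrite -prod_1subX -(prodfV _ _ (fun k => 1 - z ^+ k)).
  rewrite -[f.-1]subn1 -prodr_const_nat -big_split /= big_nat.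
  apply: rpred_prod => k kf; have cokf := coprime_lt_prime f_prime kf.
  have := Aw; rewrite -(Aint_aut (cycaut f k)).
  by rewrite fmorph_div rmorphB rmorph1 rmorph_int (cycaut_z z_prim).
have f0 : f%:R != 0 :> algC by rewrite pnatr_eq0 -lt0n prime_gt0.
move=> Aq; have : (m%:~R ^+ f.-1 == 0 %[mod f%:R])%A.
  by rewrite eqAmod0 unfold_in (negPf f0).
rewrite eqAmod0_rat ?rpredX ?rpred_int ?rpred_nat //.
rewrite -rmorphXn /= dvdC_int ?rpred_int // intrKfloor.
by rewrite dvdzE abszX Euclid_dvdX // => /andP[].
Qed.

(** Trace reconstruction puts f x in Z[z], where the polynomial Frobenius congruence applies; this
    avoids determining the ring of integers. The factor [f] is then cancelled modulo [p] by
    Bezout. *)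
Lemma cycaut_Frobenius p x : prime p -> p != f -> x \in Aint ->
  in_Q_adjoin z x -> (x ^+ p == cycaut f p x %[mod p%:R])%A.
Proof.
move=> p_pr pf Ax Qx; set tau := cycaut f.
have copf : coprime p f by rewrite prime_coprime // dvdn_prime2.
have Az := Aint_prim_root z_prim.
have [q Dq] : exists q : {poly int}, f%:R * x = (map_poly intr q).[z].
  have T_int i : cyclotomic_trace f (x * z ^+ (f - i)) \in Num.int.
    apply: Cint_rat_Aint.
      apply: (trace_rat f_prime z_prim); apply: in_Q_adjoinM => //.
      exact: in_Q_adjoinX (in_Q_adjoin_gen z).
    by apply: rpred_sum => k _; rewrite Aint_aut rpredM ?rpredX.
  exists (\poly_(i < f) Num.floor (cyclotomic_trace f (x * z ^+ (f - i)))).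
  rewrite (trace_reconstruct f_prime z_prim Qx) big_mkord.
  rewrite (@horner_coef_wide _ f); last first.
    by rewrite (leq_trans (size_poly _ _)) ?size_poly.
  apply: eq_bigr => i _; rewrite coef_map coef_poly ltn_ord /=.
  by rewrite floorK ?T_int.
have tauq : f%:R * tau p x = (map_poly intr q).[z ^+ p].
  rewrite -(rmorph_nat (tau p)) -rmorphM Dq -horner_map -map_poly_comp /=.
  rewrite (cycaut_z z_prim) //; congr _.[_].
  by apply: eq_map_poly => a /=; rewrite rmorph_int.
have := Aint_Frobenius q p_pr Az; rewrite -Dq -tauq exprMn => cong_f.
set d := x ^+ p - tau p x.
have Ad : d \in Aint by rewrite rpredB ?rpredX ?Aint_aut.
have [u [v Buv]] : exists u v : int, u * f%:Z + v * p%:Z = 1.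
  have : coprimez f p by rewrite coprimezE coprime_sym.
  by case/coprimezP => [[u v]] /= <-; exists u, v.
have p_fd : (f%:R * d == 0 %[mod p%:R])%A.
  rewrite mulrBr /eqAmod subr0 -/(eqAmod _ (f%:R * x ^+ p) _).
  apply: eqAmod_trans cong_f; apply: eqAmodMr; first by rewrite rpredX.
  by rewrite -natrX eqAmod_nat; apply/eqP/esym/fermat_little.
have Dd : d = u%:~R * (f%:R * d) + (v%:~R * d) * p%:R.
  have := congr1 (fun m : int => m%:~R * d) Buv.
  rewrite rmorphD !rmorphM /= -!pmulrn mul1r => Ed; rewrite -{1}Ed.
  by rewrite mulrDl -!mulrA [p%:R * d]mulrC.
have : (d == 0 %[mod p%:R])%A; last by rewrite eqAmod0.
rewrite Dd -[0]addr0; apply: eqAmodD.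
  by rewrite -[0](mulr0 u%:~R) eqAmodMl ?Aint_int.
by rewrite eqAmodMl0 // rpredM ?Aint_int.
Qed.

End ConductorPrime.

(** * Cubic characters *)

Lemma prime_primitive_root f : prime f -> exists2 g : nat, coprime g f &
  forall k, coprime k f -> exists i, k = g ^ i %[mod f].
Proof.
move=> f_pr.
have [u Du] := cyclicP (field_unit_group_cyclic [set: {unit 'F_f}]%G).
have Dval (x : 'F_f) : x = (x : nat)%:R :> 'F_f by rewrite natr_Zp.
exists (FinRing.uval u : nat) => [|k cokf].
  by rewrite coprime_sym -unitFpE // -Dval; apply: valP.
have Uk : (k%:R : 'F_f) \is a GRing.unit by rewrite unitFpE // coprime_sym.
have /cycleP[i Di] : FinRing.unit 'F_f Uk \in <[u]>%g by rewrite -Du inE.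
exists i; rewrite -!val_Fp_nat // natrX -Dval.
by rewrite -FinRing.val_unitX -Di.
Qed.

Lemma sum_cube_root (w : algC) : w ^+ 3 = 1 -> w != 1 -> w ^+ 2 + w + 1 = 0.
Proof.
move=> w3 w1; have: (w - 1) * (w ^+ 2 + w + 1) = 0.
  by transitivity (w ^+ 3 - 1); [ring | rewrite w3 subrr].
by move/eqP; rewrite mulf_eq0 subr_eq0 (negPf w1) => /eqP.
Qed.

Lemma cube_root_cases (w x : algC) : w ^+ 3 = 1 -> w != 1 -> x ^+ 3 = 1 ->
  [\/ x = 1, x = w | x = w ^+ 2].
Proof.
move=> w3 w1 x3; have w0 := sum_cube_root w3 w1.
have : (x - 1) * (x - w) * (x - w ^+ 2) = 0.
  transitivity ((x ^+ 3 - w ^+ 3) - (w ^+ 2 + w + 1) * (x ^+ 2 - x * w)); last first.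
    by rewrite x3 w3 w0 subrr mul0r subr0.
  ring.
move/eqP; rewrite !mulf_eq0 !subr_eq0 => /orP[/orP[]|] /eqP->.
- exact: Or31.
- exact: Or32.
- exact: Or33.
Qed.

Section Character.

Variables (f : nat) (chi : int -> algC).
Hypotheses (f_prime : prime f) (chi_char : dirichlet_character f chi).

Lemma chi_natM (m n : nat) : chi (m * n)%N = chi m * chi n.
Proof. by case: chi_char => _ chiM _ _; rewrite PoszM chiM. Qed.

Lemma chi_nat1 : chi 1%N = 1.
Proof. by case: chi_char. Qed.

Lemma chi_natX (m n : nat) : chi (m ^ n)%N = chi m ^+ n.
Proof. by elim: n => [|n IHn]; rewrite ?chi_nat1 // expnS chi_natM IHn exprS. Qed.

Lemma chi_nat_mod (m n : nat) : m = n %[mod f] -> chi m = chi n.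
Proof. by case: chi_char => _ _ chiE _ mn; apply: chiE; rewrite !modz_nat mn. Qed.

Lemma chi_nat_neq0 (n : nat) : (chi n != 0) = coprime n f.
Proof.
case: chi_char => _ _ _ chi0; have := chi0 n; rewrite coprimezE /=.
case: (coprime n f) => [] [E1 E2]; last by rewrite E2 ?eqxx.
by apply/eqP => /E1.
Qed.

Hypothesis chi_order : character_order f chi 3.

Lemma chi_nat_cube (n : nat) : coprime n f -> chi n ^+ 3 = 1.
Proof. by case: chi_order => _ chi3 _ con; apply: chi3; rewrite coprimezE. Qed.

(** At a primitive root g, chi is a primitive cube root of unity, as chi would otherwise be
    principal. So chi (g^i) = 1 forces 3 to divide i. *)
Lemma chi_eq1_cube (m : nat) : chi m = 1 ->
  exists2 n, coprime n f & m = n ^ 3 %[mod f].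
Proof.
move=> chim; have com : coprime m f by rewrite -chi_nat_neq0 chim oner_neq0.
have [g cog gen] := prime_primitive_root f_prime.
have g3 := chi_nat_cube cog.
have g1 : chi g != 1.
  apply/eqP => chig; case: chi_order => _ _ /(_ 1%N isT)[n con] /eqP; apply.
  have /= [k kn] : exists k : nat, (n = k %[mod f])%Z.
    have f0 : (f%:Z != 0) by rewrite eqz_nat -lt0n prime_gt0.
    exists `|(n %% f)%Z|%N; rewrite gez0_abs ?modz_ge0 ?modz_mod //.
  have Dn : chi n = chi k by case: chi_char => _ _ chiE _; apply: chiE.
  have cok : coprime k f.
    rewrite -chi_nat_neq0 -Dn; case: chi_char => _ _ _ chi0.
    by apply/eqP => E; have := proj1 (chi0 n) E; rewrite con.
  have [i Di] := gen _ cok.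
  by rewrite expr1 Dn (chi_nat_mod Di) chi_natX chig expr1n.
have [i Di] := gen _ com.
have gi : chi g ^+ i = 1 by rewrite -chi_natX -(chi_nat_mod Di).
have i3 : (3 %| i)%N.
  have g2 : chi g ^+ 2 != 1.
    by apply: contraNneq g1 => g2; rewrite -g3 exprSr g2 mul1r.
  move: gi; rewrite {1}(divn_eq i 3) exprD mulnC exprM g3 expr1n mul1r /dvdn.
  have := ltn_pmod i (isT : 0 < 3)%N.
  case: (i %% 3)%N => [|[|[|]]] // _ /eqP; last by rewrite (negPf g2).
  by rewrite expr1 (negPf g1).
exists (g ^ (i %/ 3))%N; first by rewrite coprimeXl.
by rewrite -expnM divnK.
Qed.

(** * Products of the 1 - z^k over the cosets of the cubes *)

Section Periods.

Variable z : algC.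
Hypothesis z_prim : f.-primitive_root z.

(** The value [c = 1] gives the element pi of norm [f]; the other cube roots of unity give its
    conjugates. *)
Definition lambda_prod (c : algC) :=
  \prod_(k : 'F_f | chi (k : nat) == c) (1 - z ^+ k).

Let val_mul (j : nat) (k : 'F_f) : (j%:R * k : 'F_f) = (j * k %% f)%N :> nat.
Proof. by rewrite -{1}[k]natr_Zp -natrM val_Fp_nat. Qed.

Lemma cycaut_lambda_prod j c : coprime j f ->
  cycaut f j (lambda_prod c) = lambda_prod (chi j * c).
Proof.
move=> coj; rewrite /lambda_prod rmorph_prod /=.
have Uj : (j%:R : 'F_f) \is a GRing.unit by rewrite unitFpE // coprime_sym.
rewrite [RHS](reindex_inj (mulrI Uj)); apply: eq_big => k.
  rewrite val_mul (chi_nat_mod (modn_mod _ _)) chi_natM.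
  by rewrite (inj_eq (mulfI _)) // chi_nat_neq0.
move=> _; rewrite rmorphB rmorph1 rmorphXn (cycaut_z z_prim) // -exprM val_mul.
by rewrite prim_expr_mod.
Qed.

Lemma in_Q_adjoin_lambda_prod c : in_Q_adjoin z (lambda_prod c).
Proof.
apply: in_Q_adjoin_prod => k _; apply: in_Q_adjoinD.
  exact: (in_Q_adjoin_nat z 1).
exact/in_Q_adjoinN/in_Q_adjoinX/in_Q_adjoin_gen.
Qed.

Lemma Aint_lambda_prod c : lambda_prod c \in Aint.
Proof.
by apply: rpred_prod => k _; rewrite rpredB ?rpred1 ?rpredX ?(Aint_prim_root z_prim).
Qed.

Lemma lambda_dvd_lambda_prod : (lambda_prod 1 == 0 %[mod 1 - z])%A.
Proof.
have val1 : (1 : 'F_f) = 1%N :> nat.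
  by rewrite -[1]/(1%N%:R) val_Fp_nat // modn_small ?prime_gt1.
rewrite /lambda_prod (bigD1 1) /= ?val1 ?chi_nat1 // expr1 eqAmodMr0 //.
by apply: rpred_prod => k _; rewrite rpredB ?rpred1 ?rpredX ?(Aint_prim_root z_prim).
Qed.

Lemma prod_lambda_prod w : w ^+ 3 = 1 -> w != 1 ->
  lambda_prod 1 * lambda_prod w * lambda_prod (w ^+ 2) = f%:R.
Proof.
move=> w3 w1.
have w0 : w != 0 by apply: contraTneq (oner_neq0 algC) => w0; rewrite -w3 w0 expr0n eqxx.
have w2 : w ^+ 2 != 1.
  by apply: contraNneq w1 => w2; rewrite -w3 exprSr w2 mul1r.
have w2w : w ^+ 2 != w by rewrite -subr_eq0 expr2 -{3}[w]mulr1 -mulrBr mulf_neq0 ?subr_eq0.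
rewrite -(prod_1subX f_prime z_prim).
have -> : \prod_(1 <= k < f) (1 - z ^+ k)
    = \prod_(k : 'F_f | chi (k : nat) != 0) (1 - z ^+ k).
  have {1}-> : f = (Zp_trunc (pdiv f)).+2 by rewrite Fp_cast.
  rewrite big_geq_mkord; apply: eq_bigl => k /=; rewrite chi_nat_neq0.
  have k_lt : (k < f)%N by rewrite -[X in (_ < X)%N](Fp_cast f_prime) ltn_ord.
  case: posnP => [->|k0]; last by rewrite coprime_lt_prime ?k0.
  by rewrite /coprime gcd0n; case: eqP f_prime => // ->.
rewrite (bigID (fun k : 'F_f => chi (k : nat) == 1)) /=.
rewrite -mulrA; congr (_ * _).
  by apply: eq_bigl => k; case: eqP => [->|]; rewrite ?oner_neq0 ?andbF.
rewrite [RHS](bigID (fun k : 'F_f => chi (k : nat) == w)) /=; congr (_ * _).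
  by apply: eq_bigl => k; case: eqP => [->|]; rewrite ?w0 ?w1 ?andbF.
apply: eq_bigl => k; have [->|k0] := eqVneq (chi k) 0.
  by rewrite eq_sym expf_eq0 (negPf w0).
have cok : coprime k f by rewrite -chi_nat_neq0.
have [] := cube_root_cases w3 w1 (chi_nat_cube cok).
- by move->; rewrite eqxx eq_sym (negPf w2).
- by move->; rewrite eqxx andbF eq_sym (negPf w2w).
by move->; rewrite eqxx w2 w2w.
Qed.

End Periods.
End Character.

(** * The cubic subfield *)

Section CubicField.

Variables (K : splittingFieldType rat) (f : nat) (chi : int -> algC).
Variables (phi : {rmorphism K -> algC}) (z : algC).
Hypotheses (f_prime : prime f) (chi_char : dirichlet_character f chi).
Hypothesis chi_order : character_order f chi 3.
Hypotheses (galK : galois 1 {:K}) (dimK : \dim {:K} = 3%N).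
Hypotheses (z_prim : f.-primitive_root z).
Hypothesis phi_z : forall x, in_Q_adjoin z (phi x).

Local Notation tau := (cycaut f).

(** [K] is normal over Q, so every automorphism of [algC] maps the image of [phi] to itself and
    restricts to [K]. *)
Lemma cycaut_gal k : {h : gal_of {:K} | h \in 'Gal({:K} / 1)%g &
  forall x, phi (h x) = tau k (phi x)}.
Proof.
have [nu nuE] := restrict_aut_to_normal_num_field phi (tau k).
have nu_kAut : kAut 1 {:K} (linfun nu).
  rewrite kAutfE; apply/kHomP; split=> [x y _ _|x].
    by rewrite !lfunE /= rmorphM.
  by case/vlineP=> a ->; rewrite lfunE /= linearZ /= rmorph1.
have [h galh Dh] := kAut_to_gal nu_kAut.
by exists h => // x; rewrite -Dh ?memvf // lfunE /= nuE.
Qed.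

Let gam k : gal_of {:K} := s2val (cycaut_gal k).

Let gam_in k : gam k \in 'Gal({:K} / 1)%g.
Proof. exact: (s2valP (cycaut_gal k)). Qed.

Let gamE k x : phi (gam k x) = tau k (phi x).
Proof. exact: (s2valP' (cycaut_gal k)). Qed.

Lemma card_gal_cubic : #|'Gal({:K} / 1)%g| = 3%N.
Proof. by rewrite -galois_dim // dimK dimv1 divn1. Qed.

Let gam3 k x : gam k (gam k (gam k x)) = x.
Proof.
have := expg_order (gam k); have := order_dvdG (gam_in k).
rewrite card_gal_cubic => /dvdnP[m Dm]; move/(congr1 (fun h => h ^+ m)%g).
rewrite -expgM mulnC -Dm expg1n => g3.
by rewrite -!galM ?memvf // -[(_ * _)%g]/(gam k ^+ 3)%g g3 gal_id.
Qed.

(** Here m is a cube n^3 modulo [f], so tau_m is the third power of tau_n, which is trivial on [K]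
    because the Galois group has order 3. *)
Lemma cycaut_cube_id (m : nat) x : chi m = 1 -> tau m (phi x) = phi x.
Proof.
move=> chim; have com : coprime m f by rewrite -(chi_nat_neq0 chi_char) chim oner_neq0.
have [n con mn] := chi_eq1_cube f_prime chi_char chi_order chim.
have con2 : coprime (n * n) f by rewrite coprimeMl con.
rewrite (cycaut_mod z_prim _ _ mn) ?coprimeXl // expnS expnS expn1.
rewrite (cycautM z_prim con con2 (phi_z x)) (cycautM z_prim con con (phi_z x)).
by rewrite -!gamE gam3.
Qed.

(** Since chi k is a primitive cube root of unity, any j coprime to [f] is moved into the kernel of
    chi by a power of k; so k and the kernel account for all automorphisms. *)
Lemma fixed_by_generator_rat k c : coprime k f -> chi k != 1 ->
    in_Q_adjoin z c -> tau k c = c -> (forall m : nat, chi m = 1 -> tau m c = c) ->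
  c \in Crat.
Proof.
move=> cok chik Qc tauk tau1c; apply: (fixed_rat f_prime z_prim Qc) => j coj.
have k3 := chi_nat_cube chi_order cok.
suff [e chije] : exists e : nat, chi (j * k ^ e)%N = 1.
  have tauke : tau (k ^ e) c = c.
    elim: e {chije} => [|e IHe]; first exact: (cycaut1 z_prim).
    by rewrite expnS (cycautM z_prim cok (coprimeXl e cok) Qc) IHe.
  by rewrite -{1}tauke -(cycautM z_prim coj (coprimeXl e cok) Qc) tau1c.
have [] := cube_root_cases k3 chik (chi_nat_cube chi_order coj) => chij.
- by exists 0%N; rewrite muln1.
- by exists 2%N; rewrite (chi_natM chi_char) (chi_natX chi_char) chij -exprS.
- by exists 1%N; rewrite (chi_natM chi_char) chij -exprSr.
Qed.

(** Otherwise all of [K] would be fixed by every automorphism, hence rational, against degree 3.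
    Thus tau_k restricts to a generator of the Galois group. *)
Lemma cycaut_moves k : coprime k f -> chi k != 1 -> exists x, gam k x != x.
Proof.
move=> cok chik.
have /subvPn[x _ x_notQ] : ~~ (fullv <= (1 : {vspace K}))%VS.
  by apply/negP => /dimvS; rewrite dimK dimv1.
exists x; apply: contra x_notQ => /eqP gx; have : phi x \in Crat.
  apply: (fixed_by_generator_rat cok chik) => // [|m chim].
    by rewrite -gamE gx.
  exact: cycaut_cube_id.
case/CratP => a Da; have -> : x = a%:A.
  by apply: (fmorph_inj phi); rewrite Da alg_num_field fmorph_rat.
by rewrite rpredZ // mem1v.
Qed.

Lemma cycaut_cube k x : tau k (tau k (tau k (phi x))) = phi x.
Proof. by rewrite -!gamE gam3. Qed.

Lemma ratr_fieldNorm k x : coprime k f -> chi k != 1 ->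
  ratr (fieldNorm x) = phi x * tau k (phi x) * tau k (tau k (phi x)).
Proof.
move=> cok chik; rewrite -(fmorph_rat phi) -alg_num_field fieldNormE //.
have gk1 : gam k != 1%g.
  have [x0] := cycaut_moves cok chik; apply: contraNneq => ->.
  by rewrite gal_id.
have galE : 'Gal({:K} / 1)%g = <[gam k]>%g.
  apply/esym/eqP; rewrite eqEcard cycle_subG gam_in card_gal_cubic /=.
  have : #[gam k]%g != 1%N by rewrite order_eq1.
  have := order_dvdG (gam_in k); rewrite card_gal_cubic /order.
  by rewrite dvdn_divisors //; case: #|_| => [|[|[|[|]]]].
have g3 : (gam k ^+ 3 = 1)%g.
  by rewrite -[3%N]card_gal_cubic galE; apply: expg_order.
have g21 : (gam k ^+ 2 != 1)%g.
  by apply: contraNneq gk1 => g2; rewrite -g3 expgS g2 mulg1.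
have g2k : (gam k ^+ 2 != gam k)%g.
  apply: contraNneq gk1 => g2.
  by apply/eqP/(mulgI (gam k)); rewrite mulg1 -[RHS]g2.
rewrite /galNorm galE (bigD1 1%g) ?group1 //= gal_id.
rewrite (bigD1 (gam k)) ?cycle_id ?gk1 //=.
rewrite (bigD1 (gam k ^+ 2)%g) ?mem_cycle ?g21 ?g2k //= big_pred0 => [|h].
  by rewrite mulr1 expgS expg1 galM ?memvf // !rmorphM /= !gamE mulrA.
apply/negP => /andP[/andP[/andP[/cyclePmin[i i_lt ->]]]].
have : (i < 3)%N by rewrite -[3%N]card_gal_cubic galE.
by case: i {i_lt} => [|[|[|]]] //; rewrite eqxx ?andbF.
Qed.

(* The conjugates of y are the values, at the conjugates of a generator x0 of K,
   of the Lagrange interpolation polynomial c2 X^2 - c1 X + c0; its coefficients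
   are Galois invariant, hence rational. *)
Lemma fixed_in_field k y : coprime k f -> chi k != 1 -> in_Q_adjoin z y ->
  (forall m : nat, chi m = 1 -> tau m y = y) -> exists x, phi x = y.
Proof.
move=> cok chik Qy tauy.
have [x0 Dx0] := cycaut_moves cok chik.
pose t0 := phi x0; pose t1 := phi (gam k x0); pose t2 := phi (gam k (gam k x0)).
pose y1 := tau k y; pose y2 := tau k y1.
have t01 : tau k t0 = t1 by rewrite -gamE.
have t12 : tau k t1 = t2 by rewrite -gamE.
have t20 : tau k t2 = t0 by rewrite -gamE gam3.
have y20 : tau k y2 = y.
  have cokk : coprime (k * k) f by rewrite coprimeMl cok.
  rewrite /y2 /y1 -(cycautM z_prim cok cok Qy) -(cycautM z_prim cok cokk Qy).
  by rewrite tauy // !(chi_natM chi_char) -expr2 -exprS (chi_nat_cube chi_order).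
have Qy1 : in_Q_adjoin z y1 by apply: (in_Q_adjoin_cycaut z_prim).
have Qy2 : in_Q_adjoin z y2 by apply: (in_Q_adjoin_cycaut z_prim).
have tauym i (m : nat) : chi m = 1 -> tau m (iter i (tau k) y) = iter i (tau k) y.
  move=> chim; have com : coprime m f by rewrite -(chi_nat_neq0 chi_char) chim oner_neq0.
  elim: i => [|i IHi]; first exact: tauy.
  have Qi : in_Q_adjoin z (iter i (tau k) y).
    by elim: i {IHi} => // i IHi; apply: (in_Q_adjoin_cycaut z_prim).
  by rewrite iterS -(cycautM z_prim com cok Qi) mulnC (cycautM z_prim cok com Qi) IHi.
have ne01 : t1 - t0 != 0 by rewrite subr_eq0 (inj_eq (fmorph_inj phi)).
have ne12 : t2 - t1 != 0 by rewrite -t12 -{2}t01 -rmorphB fmorph_eq0.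
have ne20 : t0 - t2 != 0 by rewrite -t20 -{2}t12 -rmorphB fmorph_eq0.
pose a0 := y / ((t0 - t1) * (t0 - t2)).
pose a1 := y1 / ((t1 - t2) * (t1 - t0)).
pose a2 := y2 / ((t2 - t0) * (t2 - t1)).
have ta01 : tau k a0 = a1 by rewrite fmorph_div rmorphM !rmorphB t01 t12 t20.
have ta12 : tau k a1 = a2 by rewrite fmorph_div rmorphM !rmorphB t01 t12 t20.
have ta20 : tau k a2 = a0 by rewrite fmorph_div rmorphM !rmorphB t01 t12 t20 y20.
have fix_t (m : nat) x : chi m = 1 -> tau m (phi x) = phi x by exact: cycaut_cube_id.
have fix_a (m : nat) : chi m = 1 -> [/\ tau m a0 = a0, tau m a1 = a1 & tau m a2 = a2].
  move=> chim; rewrite !fmorph_div !rmorphM !rmorphB !fix_t //.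
  have T0 : tau m y = y := tauym 0%N m chim.
  have T1 : tau m y1 = y1 := tauym 1%N m chim.
  have T2 : tau m y2 = y2 := tauym 2%N m chim.
  by rewrite T0 T1 T2.
have Qt x x' x'' : in_Q_adjoin z ((phi x - phi x') * (phi x - phi x''))^-1.
  by rewrite -!rmorphB -rmorphM -fmorphV; apply: phi_z.
have [Qa0 Qa1 Qa2] : [/\ in_Q_adjoin z a0, in_Q_adjoin z a1 & in_Q_adjoin z a2].
  by split; apply: in_Q_adjoinM => //; apply: Qt.
have Dy : a0 * ((t0 - t1) * (t0 - t2)) = y.
  by rewrite divfK // mulf_neq0 // -opprB oppr_eq0 // opprB.
clearbody a0 a1 a2.
pose c2 := a0 + a1 + a2.
pose c1 := a0 * (t1 + t2) + a1 * (t2 + t0) + a2 * (t0 + t1).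
pose c0 := a0 * (t1 * t2) + a1 * (t2 * t0) + a2 * (t0 * t1).
have rat c : tau k c = c -> (forall m : nat, chi m = 1 -> tau m c = c) ->
    in_Q_adjoin z c -> exists r, c = ratr r.
  by move=> tkc tmc Qc; apply/CratP; apply: (fixed_by_generator_rat cok chik).
have [r2 Dr2] : exists r, c2 = ratr r.
  apply: rat => [|m chim|]; last by do ![apply: in_Q_adjoinD].
    by rewrite !rmorphD ta01 ta12 ta20 addrC addrA.
  by have [E0 E1 E2] := fix_a m chim; rewrite !rmorphD E0 E1 E2.
have [r1 Dr1] : exists r, c1 = ratr r.
  apply: rat => [|m chim|].
  - by rewrite !(rmorphD, rmorphM) ta01 ta12 ta20 t01 t12 t20 addrC addrA.
  - by have [E0 E1 E2] := fix_a m chim; rewrite !(rmorphD, rmorphM) E0 E1 E2 !fix_t.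
  by do ![apply: in_Q_adjoinD | apply: in_Q_adjoinM]; first [done | apply: phi_z].
have [r0 Dr0] : exists r, c0 = ratr r.
  apply: rat => [|m chim|].
  - by rewrite !(rmorphD, rmorphM) ta01 ta12 ta20 t01 t12 t20 addrC addrA.
  - by have [E0 E1 E2] := fix_a m chim; rewrite !(rmorphD, rmorphM) E0 E1 E2 !fix_t.
  by do ![apply: in_Q_adjoinD | apply: in_Q_adjoinM]; first [done | apply: phi_z].
have lift r : exists e : K, phi e = ratr r by exists (ratr r); rewrite fmorph_rat.
have [[e0 De0] [e1 De1] [e2 De2]] := And3 (lift r0) (lift r1) (lift r2).
exists (e2 * x0 ^+ 2 - e1 * x0 + e0).
rewrite rmorphD rmorphB !rmorphM De0 De1 De2 -Dr0 -Dr1 -Dr2 -/t0.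
by rewrite -Dy /c0 /c1 /c2; ring.
Qed.

End CubicField.

(** * Norms of integers *)

Lemma eqAmodX e x y n : x \in Aint -> y \in Aint ->
  (x == y %[mod e])%A -> (x ^+ n == y ^+ n %[mod e])%A.
Proof.
move=> Ax Ay xy; elim: n => [|n IHn]; first by rewrite !expr0.
by rewrite !exprS; apply: eqAmodM; rewrite ?rpredX.
Qed.

Lemma eqAmod0_unfold e x : e != 0 :> algC ->
  (x == 0 %[mod e])%A = (x / e \in Aint).
Proof. by move=> e0; rewrite eqAmod0 unfold_in (negPf e0). Qed.

(** The quotient of tau_k y by 1 - z^k is a conjugate of an algebraic integer, and 1 - z divides 1 -
    z^k. If z = 1 the modulus is 0, and divisibility means vanishing. *)
Lemma lambda_dvd_cycaut f z k y : f.-primitive_root z -> coprime k f ->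
  (y == 0 %[mod 1 - z])%A -> (cycaut f k y == 0 %[mod 1 - z])%A.
Proof.
move=> z_prim cok; have := lambda_dvd z_prim k.
have [z1|z1] := eqVneq (1 - z) 0.
  by rewrite z1 !eqAmod0 !unfold_in eqxx => _ /eqP->; rewrite rmorph0.
have zk : 1 - z ^+ k != 0.
  rewrite -(cycaut_z z_prim cok) -(rmorph1 (cycaut f k)) -rmorphB.
  by rewrite fmorph_eq0.
rewrite !eqAmod0_unfold // => Az; rewrite -(Aint_aut (cycaut f k)).
rewrite fmorph_div rmorphB rmorph1 (cycaut_z z_prim) // => Ay.
by have := rpredM Ay Az; rewrite mulrA divfK.
Qed.

Section NormValues.

Variables (K : splittingFieldType rat) (f : nat) (chi : int -> algC).
Variables (phi : {rmorphism K -> algC}) (z : algC).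
Hypotheses (f_prime : prime f) (chi_char : dirichlet_character f chi).
Hypothesis chi_order : character_order f chi 3.
Hypotheses (galK : galois 1 {:K}) (dimK : \dim {:K} = 3%N).
Hypotheses (z_prim : f.-primitive_root z).
Hypothesis phi_z : forall x, in_Q_adjoin z (phi x).

Local Notation tau := (cycaut f).

Let fieldNorm_tau k x : coprime k f -> chi k != 1 ->
  ratr (fieldNorm x) = phi x * tau k (phi x) * tau k (tau k (phi x)).
Proof. exact: ratr_fieldNorm phi_z _ _. Qed.

Lemma fieldNorm_int (k : nat) x : coprime k f -> chi k != 1 ->
  phi x \in Aint -> exists N : int, fieldNorm x = N%:~R.
Proof.
move=> cok chik Ax; have /intrP[N DN] : ratr (fieldNorm x) \in @Num.int algC.
  apply: Cint_rat_Aint; first exact: Crat_rat.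
  by rewrite (fieldNorm_tau _ cok chik) !rpredM ?Aint_aut.
by exists N; apply: (fmorph_inj (@ratr algC)); rewrite /= DN ratr_int.
Qed.

(** Descent: as [p] is inert, p | N(x) forces p | x, and x / p has norm N / p^3. *)
Lemma logn_fieldNorm (p : nat) x (N : int) : prime p -> p != f -> chi p != 1 ->
  phi x \in Aint -> fieldNorm x = N%:~R -> N != 0 -> (3 %| logn p `|N|)%N.
Proof.
move=> p_pr pf chip; have copf : coprime p f by rewrite prime_coprime // dvdn_prime2.
have [n] := ubnP `|N|%N; elim: n => // n IHn in x N *; rewrite ltnS => leNn Ax DN N0.
have [pN|npN] := boolP (p %| `|N|)%N; last first.
  by rewrite lognE p_pr absz_gt0 N0 (negPf npN).
have p0 : p%:R != 0 :> algC by rewrite pnatr_eq0 -lt0n prime_gt0.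
pose y := phi x; have Aty k : tau k y \in Aint by rewrite Aint_aut.
have Atty k : tau k (tau k y) \in Aint by rewrite !Aint_aut.
have Qy : in_Q_adjoin z y by apply: phi_z.
have Qty : in_Q_adjoin z (tau p y) by apply: (in_Q_adjoin_cycaut z_prim).
have Qtty : in_Q_adjoin z (tau p (tau p y)) by apply: (in_Q_adjoin_cycaut z_prim).
have y1 : (y ^+ p == tau p y %[mod p%:R])%A.
  exact: (cycaut_Frobenius f_prime z_prim p_pr pf Ax Qy).
have y2 : (y ^+ (p * p) == tau p (tau p y) %[mod p%:R])%A.
  rewrite exprM; apply: (eqAmod_trans (eqAmodX p _ (Aty p) y1)).
    by rewrite rpredX.
  exact: (cycaut_Frobenius f_prime z_prim p_pr pf (Aty p) Qty).
have y3 : (y ^+ (p * p * p) == y %[mod p%:R])%A.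
  rewrite exprM; apply: (eqAmod_trans (eqAmodX p _ (Atty p) y2)).
    by rewrite rpredX.
  apply: (eqAmod_trans (cycaut_Frobenius f_prime z_prim p_pr pf (Atty p) Qtty)).
  by rewrite (cycaut_cube f phi galK dimK) ?eqAmod_refl.
have yN : (y ^+ (1 + p + p * p) == 0 %[mod p%:R])%A.
  apply: (@eqAmod_trans _ N%:~R); last first.
    case/dvdnP: pN => m Dm; rewrite -[N%:~R]/(intr N) [N]intEsg Dm.
    rewrite PoszM rmorphM /= rmorphM /= mulrA eqAmodMl0 //.
    by rewrite rpredM ?Aint_int.
  have -> : N%:~R = y * tau p y * tau p (tau p y).
    by rewrite -fieldNorm_tau // DN ratr_int.
  rewrite !exprD expr1; apply: eqAmodM => //; first by rewrite rpredM ?rpredX.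
  by apply: eqAmodM.
(* y^(1 + p + p^2) = N(y) = 0 and y^(p^3) = y modulo p, as tau_p^3 = 1 on K *)
have yp : (y == 0 %[mod p%:R])%A.
  rewrite eqAmod_sym in y3; apply: (eqAmod_trans y3).
  have le_p : (1 + p + p * p <= p * p * p)%N by have := prime_gt1 p_pr; clear; nia.
  by rewrite -(subnK le_p) exprD -[0](mulr0 (y ^+ (p * p * p - (1 + p + p * p)))) eqAmodMl ?rpredX.
have Ax' : phi (x / p%:R) \in Aint.
  by move: yp; rewrite eqAmod0 unfold_in (negPf p0) fmorph_div rmorph_nat.
have [N' DN'] := fieldNorm_int copf chip Ax'.
have NN' : N = p%:Z ^+ 3 * N'.
  apply/(intr_inj (R := algC))/eqP; rewrite rmorphM rmorphXn /=.
  rewrite -(ratr_int _ N) -(ratr_int _ N') -DN -DN' !(fieldNorm_tau _ copf chip).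
  rewrite !fmorph_div !rmorph_nat; apply/eqP; rewrite -/y; field.
  exact: p0.
have N'0 : N' != 0 by apply: contraNneq N0 => N'0; rewrite NN' N'0 mulr0.
have NabsE : `|N|%N = (p ^ 3 * `|N'|)%N by rewrite NN' abszM abszX.
rewrite NabsE lognM ?expn_gt0 ?(prime_gt0 p_pr) ?absz_gt0 // pfactorK // dvdn_addr //.
apply: (IHn _ _ _ Ax' DN' N'0); apply: leq_trans leNn; rewrite NabsE.
have p3 : (1 < p ^ 3)%N.
  apply: (leq_trans (prime_gt1 p_pr)).
  by rewrite -{1}(expn1 p) leq_exp2l ?prime_gt1.
by rewrite ltn_Pmull ?absz_gt0.
Qed.

(** The hypotheses on chi 2 make tau_2 a generator of the Galois group, so that norms can be written
    as products of conjugates under tau_2. *)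
Lemma heilbronn (a : nat) : norm_Euclidean K -> (0 < a < f)%N -> chi a = 1 ->
    chi 2 != 1 -> chi 2 != 0 ->
  exists2 x : K, phi x \in Aint &
    fieldNorm x = a%:R \/ fieldNorm x = a%:R - f%:R.
Proof.
move=> eucK /andP[a_gt0 a_lt] chia chi2 chi20.
have co2 : coprime 2 f by rewrite -(chi_nat_neq0 chi_char).
have [n con an] := chi_eq1_cube f_prime chi_char chi_order chia.
have w3 := chi_nat_cube chi_order co2.
have [pi Dpi] : exists x, phi x = lambda_prod f chi z 1.
  apply: (fixed_in_field f_prime chi_char chi_order galK dimK z_prim phi_z co2 chi2).
    exact: in_Q_adjoin_lambda_prod.
  move=> m chim; rewrite (cycaut_lambda_prod f_prime chi_char z_prim) ?chim ?mulr1 //.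
  by rewrite -(chi_nat_neq0 chi_char) chim oner_neq0.
have Api : phi pi \in Aint by rewrite Dpi (Aint_lambda_prod _ z_prim).
have Npi : ratr (fieldNorm pi) = f%:R :> algC.
  rewrite (fieldNorm_tau _ co2 chi2) Dpi !(cycaut_lambda_prod f_prime chi_char z_prim) //.
  by rewrite mulr1 -expr2 (prod_lambda_prod f_prime chi_char chi_order z_prim).
have f0 : f%:R != 0 :> algC by rewrite pnatr_eq0 -lt0n prime_gt0.
have pi0 : pi != 0.
  apply: contraNneq f0 => pi0; rewrite -Npi (fieldNorm_tau _ co2 chi2) pi0.
  by rewrite rmorph0 !mul0r.
have [b [intb Nb]] := eucK (n%:R / pi).
have Ab : phi b \in Aint.
  case: intb => q mon_q root_q.
  apply: (@root_monic_Aint (map_poly intr q)).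
  - have -> : map_poly intr q = map_poly phi (map_poly intr q).
      by rewrite -map_poly_comp; apply: eq_map_poly => i /=; rewrite rmorph_int.
    by rewrite fmorph_root.
  - by rewrite monic_map.
  by apply/polyOverP => i; rewrite coef_map rpred_int.
pose x := n%:R - pi * b.
have Ax : phi x \in Aint.
  by rewrite rmorphB rmorph_nat rmorphM rpredB ?rpredM ?rpred_nat.
exists x => //.
have [N DN] := fieldNorm_int co2 chi2 Ax.
have N_lt : `|N| < f%:Z.
  have fNpi : fieldNorm pi = f%:R.
    by apply: (fmorph_inj (@ratr algC)); rewrite /= Npi ratr_nat.
  have Dx : fieldNorm x = f%:R * fieldNorm (n%:R / pi - b).
    rewrite -fNpi; apply: (fmorph_inj (@ratr algC)); rewrite rmorphM /=.
    rewrite !(fieldNorm_tau _ co2 chi2).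
    have -> : x = pi * (n%:R / pi - b) by rewrite mulrBr mulrCA divff // mulr1.
    by rewrite !rmorphM; ring.
  rewrite -(ltr_int rat) intr_norm -DN Dx normrM normr_nat.
  by rewrite -[X in _ < X]mulr1 ltr_pM2l // ltr0n prime_gt0.
(* 1 - z divides pi, so x = n modulo 1 - z; the same holds for its conjugates, and their product is
   n^3 modulo 1 - z. *)
have Nn : (f %| N - (n ^ 3)%N%:Z)%Z.
  apply: (lambda_dvd_int f_prime z_prim).
  have xn : (phi x == n%:R %[mod 1 - z])%A.
    rewrite /x rmorphB rmorph_nat rmorphM Dpi /eqAmod addrAC subrr add0r.
    by rewrite rpredN -eqAmod0 -(mul0r (phi b)) eqAmodMr ?(lambda_dvd_lambda_prod f_prime chi_char z_prim).
  have tn y : (y == n%:R %[mod 1 - z])%A -> (tau 2 y == n%:R %[mod 1 - z])%A.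
    rewrite /eqAmod -!eqAmod0 => /(lambda_dvd_cycaut z_prim co2).
    by rewrite rmorphB rmorph_nat.
  rewrite rmorphB /= -(ratr_int _ N) -DN (fieldNorm_tau _ co2 chi2) eqAmod0.
  rewrite -[dvdA _]/(dvdA (1 - z)) -/(eqAmod _ _ _).
  rewrite -pmulrn natrX !exprS expr0 mulr1 mulrA.
  apply: eqAmodM; rewrite ?rpredM ?rpred_nat ?Aint_aut //; last by apply/tn/tn.
  by apply: eqAmodM; rewrite ?rpred_nat // tn.
have [t Dt] : exists t : int, N = a%:Z + t * f%:Z.
  have : (f %| N - a%:Z)%Z.
    have -> : N - a%:Z = (N - (n ^ 3)%N%:Z) - (a%:Z - (n ^ 3)%N%:Z) by ring.
    rewrite rpredB // -eqz_mod_dvd !modz_nat an //.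
  by case/dvdzP => t Et; exists t; rewrite -Et; ring.
have /andP[N_gtf N_ltf] : - f%:Z < N < f%:Z by rewrite -ltr_norml.
(* Since 0 < a < f, t >= 1 would give N >= f and t <= -2 would give N < -f. *)
have [t0|t1] : t = 0 \/ t = -1.
  clear -a_gt0 a_lt Dt N_gtf N_ltf.
  have t_lt : t < 1 by rewrite ltNge; apply/negP => t1; nia.
  have t_gt : -2%:Z < t by rewrite ltNge; apply/negP => t2; nia.
  lia.
  by left; rewrite DN Dt t0 mul0r addr0.
by right; rewrite DN Dt t1 mulN1r rmorphB.
Qed.

(** By [heilbronn], a or a - f would be a norm; the inert primes [p1] and [p2] exclude one each. *)
Lemma not_norm_Euclidean_criterion (a p1 p2 : nat) : chi 2 != 1 -> chi 2 != 0 ->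
    (0 < a < f)%N -> chi a = 1 ->
    prime p1 -> chi p1 != 1 -> p1 != f -> ~~ (3 %| logn p1 a)%N ->
    prime p2 -> chi p2 != 1 -> p2 != f -> ~~ (3 %| logn p2 (f - a))%N ->
  ~ norm_Euclidean K.
Proof.
move=> chi2 chi20 a_lt chia p1_pr chi1 p1f log1 p2_pr chi2' p2f log2 eucK.
have [x Ax []] := heilbronn eucK a_lt chia chi2 chi20 => DN.
  case/negP: log1; apply: (@logn_fieldNorm p1 x a%:Z) => //.
  by rewrite eqz_nat -lt0n; case/andP: a_lt.
case/negP: log2; have /andP[_ a_ltf] := a_lt.
have -> : (f - a)%N = `|a%:Z - f%:Z|%N by clear -a_ltf; lia.
apply: (@logn_fieldNorm p2 x) => //; first by rewrite rmorphB.
by clear -a_ltf; lia.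
Qed.

End NormValues.

(** * Numerical bounds *)

Lemma Z_of_leq m n : (m <= n)%N -> (Z.of_nat m <= Z.of_nat n)%coqZ.
Proof. by move/ssrnat.leP/Nat2Z.inj_le. Qed.

Lemma Z_of_expn m n : Z.of_nat (m ^ n)%N = (Z.of_nat m ^ Z.of_nat n)%coqZ.
Proof.
elim: n => [|n IHn]; first by rewrite expn0.
rewrite expnS Nat2Z.inj_mul IHn Nat2Z.inj_succ Z.pow_succ_r //.
exact: Nat2Z.is_nonneg.
Qed.

Lemma exists_isqrt c x : (0 < c)%N -> exists e,
  (c * (e * e) <= x)%N /\ (x < c * (e.+1 * e.+1))%N.
Proof.
move=> c0; have ex_e : exists e, (x < c * (e.+1 * e.+1))%N by exists x; nia.
have [e ltx mine] := ex_minnP ex_e.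
exists e; split=> //; case: e mine {ltx} => [|e mine]; first by rewrite !muln0.
by rewrite leqNgt; apply/negP => /mine; lia.
Qed.

Local Open Scope coqZ.

(** [T] is about sqrt(f/262) and [e] at most sqrt(2T), so [e] has order f^(1/4). The gap between 260
    and 262 absorbs e + 2: if 300 (e + 2) <= T, then 260 * 301^2 < 262 * 300^2 suffices. *)
Lemma approx_bounds (f T e : Z) : 100000000000000 <= f -> 0 <= e -> 0 <= T ->
    262 * (T * T) < f -> f <= 262 * ((T + 1) * (T + 1)) -> e * e <= 2 * T ->
  [/\ 260 * ((262 * (2 * e + 1)) * (262 * (2 * e + 1))) <= f,
      260 * ((T + e + 2) * (T + e + 2)) <= f & e + 2 <= T].
Proof.
move=> f14 e0 T0 Tf fT eT.
have e_am : 400 * e <= e * e + 40000.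
  by have := Z.square_nonneg (e - 200); nia.
have e_s : 100 * ((2 * e + 1) * (2 * e + 1)) <= 802 * T + 40100 by nia.
(* The first bound needs [T] above about 260 * 262 * 8.02, that is 546000. The case T < 600000 is
   void, because 262 * 600000^2 < 10^14. *)
have [T_big|T_small] := Z.le_gt_cases 600000 T.
  have TT : 600000 * T <= T * T by nia.
  have e_lt : 300 * (e + 2) <= T.
    by have [] := Z.le_gt_cases (300 * (e + 2)) T => // lt_T; nia.
  split; first by nia.
    by nia.
  by lia.
have e_lt : e <= 1100 by nia.
split; first by nia.
  by nia.
have : 1200 <= T by nia.
lia.
Qed.

Local Close Scope coqZ.

(* With t least such that f <= 262 t^2 and d^2 close to t^2 - f/262, take
   u = t - d and v = t + d; choosing between floor and ceiling for d makes
   u and v odd.  The bound on f lives in Z because the unary 10 ^ 14 makes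
   conversion diverge. *)
Lemma approx_by_product f : (100000000000000 <= Z.of_nat f)%coqZ -> exists u v s : nat,
  [/\ odd u && odd v, (260 * (u * u) <= f)%N, (260 * (v * v) <= f)%N,
      (260 * (s * s) <= f)%N
    & f = (262 * (u * v) + s)%N \/ (f + s)%N = (262 * (u * v))%N].
Proof.
move=> f14.
(* Taking the root of f - 1 instead of f makes [T.+1] the least t with f <= 262 t^2, and gives e^2
   <= 2 T below. *)
have [T [leT ltT]] := @exists_isqrt 262 f.-1 isT.
have [e [leG ltG]] := @exists_isqrt 262 (262 * (T.+1 * T.+1) - f) isT.
set G := (_ - _)%N in leG ltG.
have DG : (262 * (T.+1 * T.+1) = f + G)%N by lia.
have e2 : (e * e <= 2 * T)%N by nia.
have [e_small v_small eT] : [/\ (260 * ((262 * (2 * e + 1)) * (262 * (2 * e + 1))) <= f)%N,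
    (260 * ((T + e + 2) * (T + e + 2)) <= f)%N & (e + 2 <= T)%N].
  have [] := @approx_bounds (Z.of_nat f) (Z.of_nat T) (Z.of_nat e); try lia.
  by move=> ? ? ?; split; lia.
pose d := (e + (odd e == odd T.+1))%N.
have d_odd : odd (T.+1 + d) by rewrite /d !oddD; case: (odd e) (odd T.+1) => [] [].
have d_le : (d = e \/ d = e.+1)%N by rewrite /d; case: (_ == _); lia.
clearbody d.
have Duv : (262 * ((T.+1 - d) * (T.+1 + d)) + 262 * (d * d) = f + G)%N.
  rewrite -DG; nia.
pose s := (if (262 * (d * d) <= G)%N then G - 262 * (d * d) else 262 * (d * d) - G)%N.
(* Both G and 262 d^2 lie between 262 e^2 and 262 (e + 1)^2. *)
have s_le : (s <= 262 * (2 * e + 1))%N.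
  by rewrite /s; clear -leG ltG d_le; case: d_le => ->; case: ifP => _; lia.
have s_eq : f = (262 * ((T.+1 - d) * (T.+1 + d)) + s)%N \/
    (f + s = 262 * ((T.+1 - d) * (T.+1 + d)))%N.
  by rewrite /s; clear -Duv; case: ifP; lia.
exists (T.+1 - d)%N, (T.+1 + d)%N, s; clearbody s.
split=> //.
- by rewrite oddB ?d_odd ?andbT -?oddD //; lia.
- by apply: leq_trans v_small; rewrite leq_pmul2l // leq_mul //; lia.
- by apply: leq_trans v_small; rewrite leq_pmul2l // leq_mul //; lia.
by apply: leq_trans e_small; rewrite leq_pmul2l // leq_mul.
Qed.

Local Open Scope coqZ.

(** With n about f / (8 q), n^2 is about f^2 / (64 q^2) >= (260 / 64) f. The constant 260 exceeds 4
    * 64 = 256 by enough to absorb the loss 3 (k + 1). *)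
Lemma moment_bound_Z (f q n k : Z) : 100000000000000 <= f -> 3 <= q ->
    260 * (q * q) <= f -> f < 8 * (q * (n + 1)) -> 0 <= k -> k * (q * q) <= n ->
  3 * (k + 1) <= n /\ 4 * f < (n - 3 * (k + 1)) * (n - 3 * (k + 1)).
Proof.
move=> f14 q3 qf fn k0 kn; set m := n - 3 * (k + 1).
(* For q >= 100 the loss is a few ten-thousandths of n. For smaller q it may reach about a third of
   n, but then n > f / 800 - 1 leaves ample room. *)
have [q_big|q_small] := Z.le_gt_cases 100 q.
  have k_le : 10000 * k <= n by nia.
  have nn : 260 * f < 64 * ((n + 1) * (n + 1)).
    have : f * f < (8 * (q * (n + 1))) * (8 * (q * (n + 1))) by nia.
    nia.
  have n_big : 20000000 <= n + 1 by nia.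
  have m_big : 9996 * (n + 1) <= 10000 * m by rewrite /m; lia.
  split; first by lia.
  have : (9996 * (n + 1)) * (9996 * (n + 1)) <= (10000 * m) * (10000 * m) by nia.
  nia.
have k_le : 9 * k <= n by nia.
have n_big : f < 800 * (n + 1) by nia.
have m_big : n + 1 <= 2 * m by rewrite /m; lia.
split; first by lia.
nia.
Qed.

Local Close Scope coqZ.

Lemma moment_bound f q n k :
    (100000000000000 <= Z.of_nat f)%coqZ -> (3 <= q)%N ->
    (260 * (q * q) <= f)%N -> (f < 8 * (q * n.+1))%N -> (k * (q * q) <= n)%N ->
  exists m, (m + 3 * k.+1 = n)%N /\ (4 * f < m * m)%N.
Proof.
move=> f14 q3 qf fn kn.
have [] := @moment_bound_Z (Z.of_nat f) (Z.of_nat q) (Z.of_nat n) (Z.of_nat k);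
  try lia.
move=> k_le m_big; exists (n - 3 * k.+1)%N; split; first by lia.
have -> : (n - 3 * k.+1)%N = Z.to_nat (Z.of_nat n - 3 * (Z.of_nat k + 1))%coqZ by lia.
nia.
Qed.

(** * The second moment of character sums *)

Lemma Re_cube_root (w : algC) : w ^+ 3 = 1 -> w != 1 -> 'Re w = - 2^-1.
Proof.
move=> w3 w1; have w0 := sum_cube_root w3 w1.
have wn0 : w != 0.
  by apply: contra_eq_neq w3 => ->; rewrite expr0n eq_sym oner_neq0.
have normw : `|w| = 1.
  by apply/eqP; rewrite -(@pexpr_eq1 _ _ 3) // -normrX w3 normr1.
have conjw : w^* = w ^+ 2.
  apply: (mulfI wn0); rewrite -normCK normw -exprS w3.
  by rewrite expr1n.
rewrite ReE conjw; have -> : w + w ^+ 2 = -1.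
  by move/eqP: w0; rewrite addr_eq0 [w ^+ 2 + w]addrC => /eqP.
by rewrite mulN1r.
Qed.

Section Moment.

Variables (f : nat) (chi : int -> algC).
Hypotheses (f_prime : prime f) (chi_char : dirichlet_character f chi).
Hypothesis chi_order : character_order f chi 3.
Variable g : nat.
Hypotheses (chig0 : chi g != 0) (chig1 : chi g != 1).

Definition chiF (x : 'F_f) : algC := chi (x : nat).

Lemma chiF_nat k : chiF k%:R = chi k.
Proof.
by apply: (chi_nat_mod chi_char); rewrite val_Fp_nat // modn_mod.
Qed.

Lemma chiFM x y : chiF (x * y) = chiF x * chiF y.
Proof. by rewrite -[x]natr_Zp -[y]natr_Zp -natrM !chiF_nat (chi_natM chi_char). Qed.

Lemma chiF1 : chiF 1 = 1.
Proof. by rewrite -[1]/(1%N%:R) chiF_nat (chi_nat1 chi_char). Qed.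

Lemma chiF_eq0 x : (chiF x == 0) = (x == 0).
Proof.
have [->|x0] := eqVneq x 0.
  rewrite -[0]/(0%N%:R) chiF_nat -[_ == _]negbK (chi_nat_neq0 chi_char).
  by rewrite /coprime gcd0n; case: eqP f_prime => // ->.
apply/negbTE/eqP => chix; have := oner_neq0 algC.
by rewrite -chiF1 -(divff x0) chiFM chix mul0r eqxx.
Qed.

Lemma normC_chiF x : x != 0 -> `|chiF x| = 1.
Proof.
move=> x0; apply/eqP; rewrite -(@pexpr_eq1 _ _ 3) // -normrX.
rewrite (chi_nat_cube chi_order) ?normr1 //.
by rewrite -(chi_nat_neq0 chi_char) chiF_eq0.
Qed.

(** The substitution x -> g x multiplies the sum by chi g, which is not 1. *)
Lemma sum_chiF : \sum_x chiF x = 0.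
Proof.
have gU : (g%:R : 'F_f) != 0 by rewrite -chiF_eq0 chiF_nat.
have := reindex_inj (mulfI gU) (P := predT) (F := chiF) : \sum_x chiF x = _.
move=> E; apply/eqP; have : (chi g - 1) * \sum_x chiF x = 0.
  rewrite mulrBl mul1r {2}E mulr_sumr; apply/eqP; rewrite subr_eq0; apply/eqP.
  by apply: eq_bigr => x _; rewrite chiFM chiF_nat.
by move/eqP; rewrite mulf_eq0 subr_eq0 (negPf chig1).
Qed.

(** For a != b and y = x + a nonzero, the term is the conjugate of chi(1 + (b - a) / y). As (b - a)
    / y runs over all nonzero elements, only the conjugate of -chi(1) is left of the full sum 0. *)
Lemma correlation_chiF a b :
  \sum_x chiF (x + a) * (chiF (x + b))^* = if a == b then f.-1%:R else -1.
Proof.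
have [->|ab] := eqVneq a b.
  rewrite (reindex_inj (addIr (- b))) /=.
  rewrite (bigD1 0) //= subrK (eqP (_ : chiF 0 == 0)) ?chiF_eq0 // mul0r add0r.
  rewrite (eq_bigr (fun=> 1)) => [|x x0]; last first.
    by rewrite subrK -normCK normC_chiF ?expr1n.
  by rewrite sumr_const cardC1 card_Fp.
have d0 : b - a != 0 by rewrite subr_eq0 eq_sym.
rewrite (reindex_inj (addIr (- a))) /= (bigD1 0) //= subrK.
rewrite (eqP (_ : chiF 0 == 0)) ?chiF_eq0 // mul0r add0r.
have inv_div : involutive (fun x : 'F_f => (b - a) / x).
  move=> x; have [->|x0] := eqVneq x 0; first by rewrite !(mulr0, invr0).
  by rewrite invf_div mulrCA divff // mulr1.
transitivity (\sum_(x | x != 0) (chiF (1 + x))^*).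
  rewrite [RHS](reindex_inj (inv_inj inv_div)) /=.
  apply: eq_big => x; first by rewrite mulf_eq0 invr_eq0 (negPf d0).
  move=> x0; have -> : x - a + b = x * (1 + (b - a) / x).
    by rewrite mulrDr mulr1 mulrCA divff // mulr1 addrAC addrA.
  by rewrite subrK chiFM rmorphM mulrA -normCK normC_chiF // expr1n mul1r.
have := sum_chiF; rewrite (reindex_inj (addrI 1)) (bigD1 0) //= addr0 chiF1.
move/(congr1 (fun x : algC => x^*)); rewrite rmorphD rmorph1 rmorph0 rmorph_sum /=.
by move/eqP; rewrite addrC addr_eq0 => /eqP.
Qed.

(** On expanding the square, each diagonal pair gives f - 1 and each other pair -1, which is
    dropped. *)
Lemma second_moment_chiF n (u : 'I_n -> 'F_f) : injective u ->
  \sum_x `|\sum_i chiF (x + u i)| ^+ 2 <= (n * f)%:R.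
Proof.
move=> inj_u; under eq_bigr => x _ do rewrite normCK rmorph_sum mulr_suml.
rewrite exchange_big /= natrM mulr_natl -[X in _ *+ X]card_ord -sumr_const.
apply: ler_sum => i _; under eq_bigr => x _ do rewrite mulr_sumr.
rewrite exchange_big /= (bigD1 i) //= correlation_chiF eqxx.
apply: (@le_trans _ _ (f.-1%:R + 0)); last by rewrite addr0 ler_nat leq_pred.
rewrite lerD2l; apply: sumr_le0 => j ji; rewrite correlation_chiF.
by rewrite (inj_eq inj_u) eq_sym (negPf ji) oppr_le0 ler01.
Qed.

End Moment.

(** As 4 is invertible modulo [Q], each block of [Q] consecutive indices contains at most one. *)
Lemma card_multiples_le Q k n : (0 < Q)%N -> coprime Q 4 ->
  (#|[set a : 'I_n | Q %| k + 4 * a]| <= (n %/ Q).+1)%N.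
Proof.
move=> Q0 coQ4; have ltQ (a : 'I_n) : (a %/ Q < (n %/ Q).+1)%N.
  by rewrite ltnS leq_div2r // ltnW.
rewrite -[X in (_ <= X)%N]card_ord.
apply: (@leq_card_in _ _ (fun a => Ordinal (ltQ a))) => a b.
rewrite !inE => Qa Qb /(congr1 val) /= eq_div.
have : a = b %[mod Q].
  apply/eqP; wlog le_ba : a b Qa Qb {eq_div} / (b <= a)%N.
    by move=> IH; case/orP: (leq_total b a) => ?; [|rewrite eq_sym]; apply: IH.
  rewrite eqn_mod_dvd // -(Gauss_dvdr _ coQ4) mulnBr.
  by rewrite -(subnDl k) dvdn_sub.
by move=> eq_mod; apply: val_inj; rewrite /= (divn_eq a Q) (divn_eq b Q) eq_div eq_mod.
Qed.

(** * The second non-residue *)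

Section CubicCharacter.

Variables (f : nat) (chi : int -> algC).
Hypotheses (f_prime : prime f) (chi_char : dirichlet_character f chi).
Hypothesis chi_order : character_order f chi 3.

(** The square and the cube of chi (-1) are both 1. *)
Lemma chi_opp (n : int) : chi (- n) = chi n.
Proof.
case: chi_char => chi1 chiM _ _; rewrite -mulN1r chiM.
suff -> : chi (-1) = 1 by rewrite mul1r.
have chiN2 : chi (-1) * chi (-1) = 1 by rewrite -chiM.
have [_ chi3 _] := chi_order; have := chi3 (-1); rewrite coprimezE /= coprime1n.
by rewrite exprS expr2 chiN2 mulr1; apply.
Qed.

Lemma chi_eq1_factor (n : nat) : (0 < n)%N ->
  (forall p : nat, prime p -> (p %| n)%N -> chi p = 1) -> chi n = 1.
Proof.
have [m] := ubnP n; elim: m n => // m IHm n; rewrite ltnS => le_nm n0 chip.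
have [n1|n_gt1] := leqP n 1.
  by have -> : n = 1%N; [lia | apply: chi_nat1 chi_char].
have p_pr := pdiv_prime n_gt1; have p_gt1 := prime_gt1 p_pr.
have Dn : n = (pdiv n * (n %/ pdiv n))%N by rewrite mulnC divnK ?pdiv_dvd.
have n'_gt0 : (0 < n %/ pdiv n)%N by rewrite divn_gt0 ?pdiv_gt0 // pdiv_leq.
rewrite Dn (chi_natM chi_char) chip ?pdiv_dvd // mul1r; apply: IHm => //.
  by apply: leq_trans le_nm; rewrite ltn_Pdiv.
by move=> p p_pr' p_dvd; apply: chip => //; rewrite Dn dvdn_mull.
Qed.

Lemma inj_progression k n : odd f -> (n <= f)%N ->
  injective (fun a : 'I_n => (k + 4 * a)%:R : 'F_f).
Proof.
move=> f_odd le_nf a b /(congr1 val) /=; rewrite !val_Fp_nat // => /eqP.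
rewrite eqn_modDl => /eqP E; apply: val_inj => /=; apply/eqP.
wlog le_ba : a b E / (b <= a)%N.
  by move=> IH; case/orP: (leq_total b a) => ?; [|rewrite eq_sym]; apply: IH.
rewrite eqn_leq le_ba andbT -subn_eq0.
have : (f %| 4 * (a - b))%N by rewrite mulnBr -eqn_mod_dvd ?leq_mul ?E.
rewrite Gauss_dvdr; last by rewrite -[4%N]/(2 ^ 2)%N coprimeXr // coprimen2.
apply: contraLR; rewrite -lt0n => /gtnNdvd -> //.
by rewrite (leq_ltn_trans (leq_subr _ _)) // (leq_trans (ltn_ord a)).
Qed.

(** * Small second non-residue: a suitable multiple of q by the second moment *)

Section SmallNonresidue.

Variable q : nat.
Hypotheses (f_large : (100000000000000 <= Z.of_nat f)%coqZ) (q_prime : prime q) (q_gt2 : (2 < q)%N).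
Hypothesis q_small : (260 * (q * q) <= f)%N.
Hypothesis chiq : cubic_nonresidue chi q.

Lemma exists_residue_multiple : exists a : nat,
  [/\ (0 < a < f)%N, chi a = 1, ~~ (3 %| logn q a)%N & ((f - a) %% 4 = 2)%N].
Proof.
pose P (a : nat) := [&& (0 < a < f)%N, chi a == 1, ~~ (3 %| logn q a)%N
  & ((f - a) %% 4 == 2)%N].
(* For a, b < n this gives r = c + 4 (a + b) < 8 n, hence q r < f. *)
pose n := (f %/ (8 * q))%N.
have q_gt0 : (0 < q)%N by lia.
have f_gt3 : (3 < f)%N by nia.
have q_odd : odd q by case: (even_prime q_prime) q_gt2 => [->|].
have f_odd : odd f by case: (even_prime f_prime) f_gt3 => [->|].
have len : (8 * q * n <= f)%N by rewrite mulnC leq_divM.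
have ltn : (f < 8 * (q * n.+1))%N by rewrite mulnA mulnC ltn_ceil ?muln_gt0.
have ltnf : (n < f)%N by nia.
(* As q and f are odd, one of c = 1, 3 makes f - q c congruent to 2 modulo 4, and adding multiples
   of 4 to c keeps this. *)
have [c [c_lt c_odd fqc]] : exists c, [/\ (c < 4)%N, odd c & ((q * c + 2) %% 4 = f %% 4)%N].
  have [E|E] := eqVneq ((q * 1 + 2) %% 4)%N (f %% 4)%N; first by exists 1%N.
  exists 3%N; split => //; clear -E q_odd f_odd; lia.
pose r (a b : nat) := (c + 4 * b + 4 * a)%N.
suff /existsP[b /existsP[a Pab]] :
    [exists b : 'I_n, [exists a : 'I_n, P (q * r a b)%N]].
  by exists (q * r a b)%N; case/and4P: Pab => -> /eqP -> -> /eqP ->.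
apply: contraT => noP.
have r_gt0 a b : (0 < r a b)%N by rewrite /r; case: c c_odd {fqc c_lt r noP}.
have qr_lt (a b : 'I_n) : (q * r a b < f)%N.
  have r_lt : (r a b < 8 * n)%N.
    by rewrite /r; have := ltn_ord a; have := ltn_ord b; clear -c_lt; lia.
  by clear -r_lt len q_gt0; nia.
(* If q^2 does not divide r, the exponent of q in q r is 1 or 2, so q r would meet all the
   requirements. *)
have chi_r (a b : 'I_n) : chi (q * r a b)%N = 1 -> (q * q %| c + 4 * b + 4 * a)%N.
  move=> chir; apply/negPn/negP => Qr; case/negP: noP.
  apply/existsP; exists b; apply/existsP; exists a; apply/and4P; split.
  - by rewrite muln_gt0 q_gt0 r_gt0 qr_lt.
  - exact/eqP.
  - rewrite lognM ?r_gt0 // logn_prime // eqxx.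
    have : (logn q (r a b) < 2)%N by rewrite ltnNge -pfactor_dvdn ?r_gt0.
    by case: (logn q (r a b)) => [|[|]].
  have Dqr : (q * r a b = q * c + 4 * (q * (a + b)))%N by rewrite /r; ring.
  move: (q * r a b)%N (q * (a + b))%N (q * c)%N Dqr (qr_lt a b) fqc.
  by clear => x y w; lia.
have [m [Dm m_big]] :=
  moment_bound f_large q_gt2 q_small ltn (leq_divM n (q * q)).
have coQ4 : coprime (q * q) 4.
  by rewrite coprimeMl andbb -[4%N]/(2 ^ 2)%N coprimeXr // coprimen2.
pose u (a : 'I_n) : 'F_f := (4 * a)%:R.
pose v (b : 'I_n) : 'F_f := (c + 4 * b)%:R.
have inj_v : injective v by apply: inj_progression; rewrite // ltnW.
have inj_u : injective u by apply: (@inj_progression 0); rewrite // ltnW.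
have /andP[chiq0 chiq1] := chiq.
have normq : `|chi q| = 1.
  apply/eqP; rewrite -(@pexpr_eq1 _ _ 3) // -normrX (chi_nat_cube chi_order) ?normr1 //.
  by rewrite -(chi_nat_neq0 chi_char).
(* Re (chi (q r)) is -1/2 unless chi (q r) = 1, which forces q^2 | r. *)
have low b : (m%:R / 2) ^+ 2 <= `|\sum_a chiF chi (v b + u a)| ^+ 2.
  rewrite ler_pXn2r ?nnegrE ?divr_ge0 ?ler0n //.
  rewrite [X in _ <= X](_ : _ = `|chi q * \sum_a chiF chi (v b + u a)|); last first.
    by rewrite normrM normq mul1r.
  rewrite mulr_sumr (eq_bigr (fun a : 'I_n => chi (q * r a b)%N)) => [|a _]; last first.
    by rewrite /v /u -natrD (chiF_nat f_prime chi_char) (chi_natM chi_char).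
  set S := \sum_a _; pose C := #|[set a : 'I_n | q * q %| c + 4 * b + 4 * a]%N|.
  (* At most [C] terms may reach 1 and the others are -1/2, so |S| >= - Re S >= (n - 3 C) / 2 >= m /
     2. *)
  have ReS : 'Re S <= (3 * C)%:R / 2 - n%:R / 2.
    rewrite /S raddf_sum /=.
    apply: (@le_trans _ _ (\sum_(a < n)
        ((3 * (q * q %| c + 4 * b + 4 * a))%N%:R / 2 - 2^-1))).
      apply: ler_sum => a _; have [chir|chir] := eqVneq (chi (q * r a b)%N) 1.
        rewrite chir (chi_r _ _ chir) (Creal_ReP _ _) ?rpred1 //.
        by rewrite (_ : _ - _ = 1) //= muln1; field.
      rewrite Re_cube_root // ?lerDr ?divr_ge0 ?ler0n //.
      rewrite (chi_nat_cube chi_order) // coprime_lt_prime ?qr_lt //.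
      by rewrite muln_gt0 q_gt0 r_gt0.
    rewrite big_split /= sumr_const card_ord -mulr_suml -natr_sum.
    rewrite -big_distrr /= mulNrn [n%:R / 2]mulr_natl lerD2r.
    rewrite ler_pM2r ?invr_gt0 ?ltr0n // ler_nat leq_mul2l /= /C.
    by rewrite -sum1dep_card [X in (_ <= X)%N]big_mkcond.
  have leC : (m + 3 * C <= n)%N.
    rewrite -Dm leq_add2l leq_mul2l /= card_multiples_le ?muln_gt0 ?q_gt0 //.
  apply: le_trans (leif_normC_Re_Creal _); rewrite -(normrN ('Re S)).
  have SR : - 'Re S \is Num.real by rewrite rpredN Creal_Re.
  apply: le_trans (real_ler_norm SR).
  rewrite lerNr (le_trans ReS) // -mulrBl -mulNr.
  rewrite ler_pM2r ?invr_gt0 ?ltr0n // lerBlDr addrC lerBrDr -natrD ler_nat.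
  by rewrite addnC.
have := second_moment_chiF f_prime chi_char chi_order chiq0 chiq1 inj_u.
(* Keeping only the n points [v b] of the second moment already gives n (m/2)^2 <= n f, against m^2
   > 4 f. *)
rewrite (bigID (mem (v @: [set: 'I_n]))) /= big_imset /=; last by move=> ? ? _ _ /inj_v.
set S1 := \sum_(_ in _) _; set S2 := \sum_(_ | _) _ => S_le.
have S1_ge : n%:R * (m%:R / 2) ^+ 2 <= S1.
  rewrite /S1 -[n in n%:R]card_ord mulr_natl -cardsT -sumr_const.
  by apply: ler_sum => b _; apply: low.
have S2_ge : 0 <= S2 by apply: sumr_ge0 => x _; rewrite exprn_ge0.
have : n%:R * (m%:R / 2) ^+ 2 <= (n * f)%:R :> algC.
  by apply: le_trans S1_ge _; apply: le_trans S_le; rewrite lerDl.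
rewrite natrM expr_div_n mulrA ler_pdivrMr ?exprn_gt0 ?ltr0n // -!natrX -!natrM ler_nat.
have n_gt0 : (0 < n)%N by rewrite -Dm addnS.
by rewrite leqNgt; case/negP; clear -m_big n_gt0; nia.
Qed.

End SmallNonresidue.

(** * Large second non-residue: a contradiction from f = 262 u v +- s *)

Section LargeNonresidue.

Variable q : nat.
Hypotheses (f_large : (100000000000000 <= Z.of_nat f)%coqZ) (q_large : (f < 260 * (q * q))%N).
Hypothesis chi2 : cubic_nonresidue chi 2.
Hypothesis residues : forall p : nat, prime p -> odd p -> (p < q)%N ->
  ~~ cubic_nonresidue chi p.

Lemma no_large_nonresidue : False.
Proof.
have [u [v [s [/andP[u_odd v_odd] u_small v_small s_small fE]]]] :=
  approx_by_product f_large.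
have f_pr2 : odd f.
  case: (even_prime f_prime) => // f2; move: v_small; rewrite f2.
  by have := odd_gt0 v_odd; nia.
(* From 260 n^2 <= f < 260 q^2 follows n < q, so all prime factors of n are odd primes below q. *)
have chi_odd n : odd n -> (260 * (n * n) <= f)%N -> chi n = 1.
  move=> n_odd n_small; have n_gt0 := odd_gt0 n_odd.
  apply: chi_eq1_factor => // p p_pr p_n.
  have le_pn := dvdn_leq n_gt0 p_n.
  have p_lt : (p < q)%N by nia.
  have p_ltf : (p < f)%N by nia.
  have p_odd : odd p.
    case: (even_prime p_pr) => // p2; move: p_n.
    by rewrite p2 dvdn2 n_odd.
  apply/eqP; have := residues p_pr p_odd p_lt; rewrite /cubic_nonresidue.
  by rewrite (chi_nat_neq0 chi_char) coprime_lt_prime ?prime_gt0 //= negbK.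
(* The constant 262 = 2 * 131 is twice an odd number, so only the factor 2 keeps a nontrivial
   character value. *)
have chi131 : chi 131%N = 1.
  by apply: chi_odd => //; clear -f_large; lia.
have chiuv : chi (262 * (u * v))%N = chi 2.
  rewrite -[262%N]/(2 * 131)%N !(chi_natM chi_char) chi131.
  by rewrite (chi_odd u) // (chi_odd v) // !mulr1.
have s_odd : odd s.
  have uv_odd : odd (u * v) by rewrite oddM u_odd.
  by case: fE => E; move: f_pr2; [rewrite E oddD oddM | move: (congr1 odd E);
    rewrite oddD oddM; case: (odd f) (odd s) => [] []].
(* Modulo f, s is 262 u v up to sign, and chi ignores the sign. *)
have chi_s : chi s = chi 2.
  rewrite -chiuv; have [chi1 chiM chiE _] := chi_char.
  case: fE => [|/esym] E.
    rewrite -chi_opp; apply: chiE; apply/eqP; rewrite eqz_mod_dvd.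
    by rewrite -opprD -PoszD addnC -E rpredN dvdzz.
  apply: chiE; apply/eqP; rewrite eq_sym eqz_mod_dvd.
  by rewrite E PoszD addrK dvdzz.
by case/andP: chi2 => _; rewrite -chi_s chi_odd ?eqxx.
Qed.

End LargeNonresidue.
End CubicCharacter.

Theorem theorem10 (K : splittingFieldType rat) (f : nat)
    (chi : int -> algC) (q1 q2 : nat)
    (K_cubic : cyclic_cubic K)
    (f_cond : is_conductor K f)
    (f_prime : prime f)
    (f_mod3 : f = 1 %[mod 3])
    (f_large : (10 ^ 14 <= f)%N)
    (chi_char : dirichlet_character f chi)
    (chi_order : character_order f chi 3)
    (q12 : two_smallest_prime_nonresidues chi q1 q2)
    (q1_eq2 : q1 = 2%N) :
  ~ norm_Euclidean K.
Proof.
have f14 : (100000000000000 <= Z.of_nat f)%coqZ.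
  by have := Z_of_leq f_large; rewrite Z_of_expn; exact.
clear f_large; subst q1.
have [galK _ dimK] := K_cubic.
have [[phi [z [z_prim phi_z]]] _] := f_cond.
have [/andP[_ chi2] /andP[q2_prime chiq2] q2_gt2 q_min] := q12.
have [chi2_neq0 chi2_neq1] := andP chi2.
have [chiq2_neq0 chiq2_neq1] := andP chiq2.
have neq_f (p : nat) : chi p != 0 -> p != f.
  rewrite (chi_nat_neq0 chi_char); apply: contraTneq => ->.
  by rewrite /coprime gcdnn neq_ltn prime_gt1 ?orbT.
have [q_small|q_large] := leqP (260 * (q2 * q2))%N f; last first.
  have [] := no_large_nonresidue f_prime chi_char chi_order f14 q_large chi2.
  move=> p p_prime p_odd p_lt; apply/negP => chip.
  have [_ le_q2p] := q_min p p_prime chip.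
  have /le_q2p : p <> 2 by move=> p2; rewrite p2 in p_odd.
  by rewrite leqNgt p_lt.
have [a [a_lt chia logq fa]] := exists_residue_multiple f_prime chi_char
  chi_order f14 q2_prime q2_gt2 q_small chiq2.
(* f - a is 2 modulo 4, so the inert prime 2 excludes a - f as a norm, while q2 excludes a. *)
have log2 : logn 2 (f - a) = 1%N.
  have fa_gt0 : (0 < f - a)%N by case/andP: a_lt; rewrite subn_gt0.
  apply/eqP; rewrite eqn_leq -ltnS ltnNge -!pfactor_dvdn //.
  by rewrite /dvdn fa /=; move: fa; clear; lia.
apply: (not_norm_Euclidean_criterion f_prime chi_char chi_order galK dimK z_prim
  phi_z chi2_neq1 chi2_neq0 a_lt chia q2_prime chiq2_neq1 _ logq _ chi2_neq1) => //.
- exact: neq_f.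
- exact: neq_f.
by rewrite log2.
Qed.
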